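(* $\mathsf{iK_d}$ and $\mathsf{iK_{d*}}$ are the logics of the calculi $\mathbf{iK_d}$ and $\mathbf{iK_{d*}}$, respectively; that is, for every $\mathcal{L}$-formula $A$, $A\in\mathsf{iK_d}$ if and only if $\mathbf{iK_d}\vdash\,\Rightarrow A$, and for every $\mathcal{L}_*$-formula $A$, $A\in\mathsf{iK_{d*}}$ if and only if $\mathbf{iK_{d*}}\vdash\,\Rightarrow A$. Moreover, $\mathsf{iK_d}$ is conservative over $\mathsf{iK_{d*}}$; that is, for every $\mathcal{L}_*$-formula $A$, $A\in\mathsf{iK_d}$ if and only if $A\in\mathsf{iK_{d*}}$.
   Context: Language and sequents. Fix a set $V$ of atomic propositions. $\mathcal{L}$-formulas are built from atoms in $V$ and the constants $\top,\bot$ using binary connectives $\wedge,\vee,\supset,\to$ and the unary connective $\nabla$. $\mathcal{L}_*$-formulas are the $\mathcal{L}$-formulas without $\supset$. ''Formula'' means $\mathcal{L}$-formula unless stated otherwise. $\nabla^n A$ is the $n$-fold application of $\nabla$ to $A$, and $\nabla^n\Gamma$ is the multiset $\{\nabla^n A \mid A\in\Gamma\}$. A sequent over $\mathfrak{L}\in\{\mathcal{L},\mathcal{L}_*\}$ is an expression $\Gamma\Rightarrow\Delta$ with $\Gamma,\Delta$ finite multisets of $\mathfrak{L}$-formulas, $\Delta$ containing at most one formula. Comma is multiset union; a formula stands for its singleton. Rules are written ''premises / conclusion''; $\Gamma,\Sigma$ are arbitrary finite multisets, $\Delta$ has at most one formula, $A,B$ are arbitrary formulas, $n\ge 0$ is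 an arbitrary natural number. Calculus $\mathbf{STL(N,H)}$ (over $\mathcal{L}$). Axioms: $(Id)$ $A\Rightarrow A$; $(L\bot)$ $\bot\Rightarrow$; $(R\top)$ $\Rightarrow\top$. $(Lw)$ $\Gamma\Rightarrow\Delta$ / $\Gamma,A\Rightarrow\Delta$. $(Rw)$ $\Gamma\Rightarrow$ / $\Gamma\Rightarrow A$. $(Lc)$ $\Gamma,A,A\Rightarrow\Delta$ / $\Gamma,A\Rightarrow\Delta$. $(cut)$ $\Gamma\Rightarrow A$ and $\Sigma,A\Rightarrow\Delta$ / $\Sigma,\Gamma\Rightarrow\Delta$. $(L\wedge_1)$ $\Gamma,A\Rightarrow\Delta$ / $\Gamma,A\wedge B\Rightarrow\Delta$. $(L\wedge_2)$ $\Gamma,B\Rightarrow\Delta$ / $\Gamma,A\wedge B\Rightarrow\Delta$. $(R\wedge)$ $\Gamma\Rightarrow A$ and $\Gamma\Rightarrow B$ / $\Gamma\Rightarrow A\wedge B$. $(L\vee)$ $\Gamma,A\Rightarrow\Delta$ and $\Gamma,B\Rightarrow\Delta$ / $\Gamma,A\vee B\Rightarrow\Delta$. $(R\vee_1)$ $\Gamma\Rightarrow A$ / $\Gamma\Rightarrow A\vee B$. $(R\vee_2)$ $\Gamma\Rightarrow B$ / $\Gamma\Rightarrow A\vee B$. $(N)$ $\Gamma\Rightarrow\Delta$ / $\nabla\Gamma\Rightarrow\nabla\Delta$. $(L\to)$ $\Gamma\Rightarrow A$ and $\Gamma,B\Rightarrow\Delta$ / $\Gamma,\nabla(A\to B)\Rightarrow\Delta$.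 $(R\to)$ $\nabla\Gamma,A\Rightarrow B$ / $\Gamma\Rightarrow A\to B$. $(L\supset)$ $\Gamma\Rightarrow A$ and $\Gamma,B\Rightarrow\Delta$ / $\Gamma,A\supset B\Rightarrow\Delta$. $(R\supset)$ $\Gamma,A\Rightarrow B$ / $\Gamma\Rightarrow A\supset B$. $\mathbf{STL(N)}$ is the calculus over $\mathcal{L}_*$ with the same rules except $(L\supset)$ and $(R\supset)$. Calculus $\mathbf{iK_d}$ (over $\mathcal{L}$). Axioms: $(Id^p)$ $p\Rightarrow p$ for $p$ an atom; $(L\bot)$ $\bot\Rightarrow$; $(R\top)$ $\Rightarrow\top$. $(LW)$ $\Gamma\Rightarrow\Delta$ / $\Gamma,\Sigma\Rightarrow\Delta$. $(Rw)$ $\Gamma\Rightarrow$ / $\Gamma\Rightarrow A$. $(L\wedge^n)$ $\Gamma,\nabla^nA,\nabla^nB\Rightarrow\Delta$ / $\Gamma,\nabla^n(A\wedge B)\Rightarrow\Delta$. $(R\wedge)$ $\Gamma\Rightarrow A$ and $\Gamma\Rightarrow B$ / $\Gamma\Rightarrow A\wedge B$. $(L\vee^n)$ $\Gamma,\nabla^nA\Rightarrow\Delta$ and $\Gamma,\nabla^nB\Rightarrow\Delta$ / $\Gamma,\nabla^n(A\vee B)\Rightarrow\Delta$. $(R\vee_1)$ $\Gamma\Rightarrow A$ / $\Gamma\Rightarrow A\vee B$. $(R\vee_2)$ $\Gamma\Rightarrow B$ / $\Gamma\Rightarrow A\vee B$. $(L\to^n)$ $\Gamma,\nabla^{n+1}(A\to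 B)\Rightarrow\nabla^nA$ and $\Gamma,\nabla^{n+1}(A\to B),\nabla^nB\Rightarrow\Delta$ / $\Gamma,\nabla^{n+1}(A\to B)\Rightarrow\Delta$. $(R\to)$ $\nabla\Gamma,A\Rightarrow B$ / $\Gamma\Rightarrow A\to B$. $(L\supset^n)$ $\Gamma,\nabla^n(A\supset B)\Rightarrow\nabla^nA$ and $\Gamma,\nabla^nB\Rightarrow\Delta$ / $\Gamma,\nabla^n(A\supset B)\Rightarrow\Delta$. $(R\supset)$ $\Gamma,A\Rightarrow B$ / $\Gamma\Rightarrow A\supset B$. $(N)$ $\Gamma\Rightarrow\Delta$ / $\nabla\Gamma\Rightarrow\nabla\Delta$. $\mathbf{iK_{d*}}$ is the calculus over $\mathcal{L}_*$ with the same axioms and rules as $\mathbf{iK_d}$ except $(L\supset^n)$ and $(R\supset)$. For a calculus $G$, $G\vdash S$ means that the sequent $S$ has a proof-tree in $G$ (without assumptions). The logic of a calculus $G$ is the set of formulas $A$ (of the language of $G$) with $G\vdash\,\Rightarrow A$. By definition, $\mathsf{iK_d}$ is the logic of $\mathbf{STL(N,H)}$ and $\mathsf{iK_{d*}}$ is the logic of $\mathbf{STL(N)}$. *)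

(* Defs.v *)
From Stdlib Require Export List Permutation.
Export ListNotations.
Set Implicit Arguments.

Inductive formula (V : Type) : Type :=
| Atom (p : V)
| Top
| Bot
| And (A B : formula V)
| Or (A B : formula V)
| Sup (A B : formula V)  (* A ⊃ B, the implication absent from [L_star] *)
| Arr (A B : formula V)  (* A → B, the implication adjoint to [Nabla] *)
| Nabla (A : formula V).

Arguments Top {V}.
Arguments Bot {V}.

Definition nabla_n (V : Type) (n : nat) (A : formula V) : formula V :=
  Nat.iter n (@Nabla V) A.

Definition L_full (V : Type) (A : formula V) : Prop := True.

Fixpoint L_star (V : Type) (A : formula V) : Prop :=
  match A with
  | Atom _ | Top | Bot => True
  | And B C | Or B C | Arr B C => L_star B /\ L_star C
  | Sup _ _ => False
  | Nabla B => L_star B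
  end.

(* The antecedent is a finite multiset: a list considered up to [Permutation]
   (see [sequent_eq] and its use in [provable]). *)
Record sequent (V : Type) : Type := Sequent {
  antecedent : list (formula V);
  succedent : option (formula V)
}.

Notation "Γ ⇒ Δ" := (Sequent Γ Δ) (at level 70, no associativity).

Definition sequent_eq (V : Type) (S T : sequent V) : Prop :=
  Permutation (antecedent S) (antecedent T) /\ succedent S = succedent T.

Definition sequent_over (V : Type) (L : formula V -> Prop) (S : sequent V)
    : Prop :=
  (forall A, In A (antecedent S) -> L A) /\
  (forall A, succedent S = Some A -> L A).

(* [rule ps c]: c follows from the list of premises ps by an instance of a rule
   (an axiom when ps is empty). *)
Record calculus (V : Type) : Type := Calculus {
  lang : formula V -> Prop;
  rule : list (sequent V) -> sequent V -> Prop
}.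

(* Existence of a proof-tree all of whose sequents are over the language of the
   calculus.  Rule schemata are written on lists; [sequent_eq] lets the sequent
   at a node be any list representing the same multiset as the conclusion of
   the rule instance. *)
Inductive provable (V : Type) (G : calculus V) : sequent V -> Prop :=
| provable_node ps c S :
    rule G ps c ->
    sequent_eq c S ->
    sequent_over (lang G) S ->
    (forall P, In P ps -> provable G P) ->
    provable G S.

Definition logic (V : Type) (G : calculus V) (A : formula V) : Prop :=
  lang G A /\ provable G ([] ⇒ Some A).

Inductive STL_N_rule (V : Type) : list (sequent V) -> sequent V -> Prop :=
| stl_Id A : STL_N_rule [] ([A] ⇒ Some A)
| stl_Lbot : STL_N_rule [] ([Bot] ⇒ None)
| stl_Rtop : STL_N_rule [] ([] ⇒ Some Top)
| stl_Lw Γ Δ A : STL_N_rule [Γ ⇒ Δ] (A :: Γ ⇒ Δ)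
| stl_Rw Γ A : STL_N_rule [Γ ⇒ None] (Γ ⇒ Some A)
| stl_Lc Γ Δ A : STL_N_rule [A :: A :: Γ ⇒ Δ] (A :: Γ ⇒ Δ)
| stl_cut Γ Σ Δ A :
    STL_N_rule [Γ ⇒ Some A; A :: Σ ⇒ Δ] (Σ ++ Γ ⇒ Δ)
| stl_Land1 Γ Δ A B : STL_N_rule [A :: Γ ⇒ Δ] (And A B :: Γ ⇒ Δ)
| stl_Land2 Γ Δ A B : STL_N_rule [B :: Γ ⇒ Δ] (And A B :: Γ ⇒ Δ)
| stl_Rand Γ A B :
    STL_N_rule [Γ ⇒ Some A; Γ ⇒ Some B] (Γ ⇒ Some (And A B))
| stl_Lor Γ Δ A B :
    STL_N_rule [A :: Γ ⇒ Δ; B :: Γ ⇒ Δ] (Or A B :: Γ ⇒ Δ)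
| stl_Ror1 Γ A B : STL_N_rule [Γ ⇒ Some A] (Γ ⇒ Some (Or A B))
| stl_Ror2 Γ A B : STL_N_rule [Γ ⇒ Some B] (Γ ⇒ Some (Or A B))
| stl_N Γ Δ :
    STL_N_rule [Γ ⇒ Δ] (map (@Nabla V) Γ ⇒ option_map (@Nabla V) Δ)
| stl_Larr Γ Δ A B :
    STL_N_rule [Γ ⇒ Some A; B :: Γ ⇒ Δ] (Nabla (Arr A B) :: Γ ⇒ Δ)
| stl_Rarr Γ A B :
    STL_N_rule [A :: map (@Nabla V) Γ ⇒ Some B] (Γ ⇒ Some (Arr A B)).

Inductive STL_NH_rule (V : Type) : list (sequent V) -> sequent V -> Prop :=
| stl_N_rule ps c : STL_N_rule ps c -> STL_NH_rule ps c
| stl_Lsup Γ Δ A B :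
    STL_NH_rule [Γ ⇒ Some A; B :: Γ ⇒ Δ] (Sup A B :: Γ ⇒ Δ)
| stl_Rsup Γ A B :
    STL_NH_rule [A :: Γ ⇒ Some B] (Γ ⇒ Some (Sup A B)).

Inductive iKd_star_rule (V : Type) : list (sequent V) -> sequent V -> Prop :=
| ikd_Idp p : iKd_star_rule [] ([Atom p] ⇒ Some (Atom p))
| ikd_Lbot : iKd_star_rule [] ([Bot] ⇒ None)
| ikd_Rtop : iKd_star_rule [] ([] ⇒ Some Top)
| ikd_LW Γ Σ Δ : iKd_star_rule [Γ ⇒ Δ] (Γ ++ Σ ⇒ Δ)
| ikd_Rw Γ A : iKd_star_rule [Γ ⇒ None] (Γ ⇒ Some A)
| ikd_Land n Γ Δ A B :
    iKd_star_rule [nabla_n n A :: nabla_n n B :: Γ ⇒ Δ]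
      (nabla_n n (And A B) :: Γ ⇒ Δ)
| ikd_Rand Γ A B :
    iKd_star_rule [Γ ⇒ Some A; Γ ⇒ Some B] (Γ ⇒ Some (And A B))
| ikd_Lor n Γ Δ A B :
    iKd_star_rule [nabla_n n A :: Γ ⇒ Δ; nabla_n n B :: Γ ⇒ Δ]
      (nabla_n n (Or A B) :: Γ ⇒ Δ)
| ikd_Ror1 Γ A B : iKd_star_rule [Γ ⇒ Some A] (Γ ⇒ Some (Or A B))
| ikd_Ror2 Γ A B : iKd_star_rule [Γ ⇒ Some B] (Γ ⇒ Some (Or A B))
| ikd_Larr n Γ Δ A B :
    iKd_star_rule
      [nabla_n (S n) (Arr A B) :: Γ ⇒ Some (nabla_n n A);
       nabla_n n B :: nabla_n (S n) (Arr A B) :: Γ ⇒ Δ]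
      (nabla_n (S n) (Arr A B) :: Γ ⇒ Δ)
| ikd_Rarr Γ A B :
    iKd_star_rule [A :: map (@Nabla V) Γ ⇒ Some B] (Γ ⇒ Some (Arr A B))
| ikd_N Γ Δ :
    iKd_star_rule [Γ ⇒ Δ] (map (@Nabla V) Γ ⇒ option_map (@Nabla V) Δ).

Inductive iKd_rule (V : Type) : list (sequent V) -> sequent V -> Prop :=
| ikd_star_rule ps c : iKd_star_rule ps c -> iKd_rule ps c
| ikd_Lsup n Γ Δ A B :
    iKd_rule
      [nabla_n n (Sup A B) :: Γ ⇒ Some (nabla_n n A); nabla_n n B :: Γ ⇒ Δ]
      (nabla_n n (Sup A B) :: Γ ⇒ Δ)
| ikd_Rsup Γ A B :
    iKd_rule [A :: Γ ⇒ Some B] (Γ ⇒ Some (Sup A B)).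

Definition STL_NH (V : Type) : calculus V :=
  Calculus (@L_full V) (@STL_NH_rule V).
Definition STL_N (V : Type) : calculus V :=
  Calculus (@L_star V) (@STL_N_rule V).
Definition iKd_calc (V : Type) : calculus V :=
  Calculus (@L_full V) (@iKd_rule V).
Definition iKd_star_calc (V : Type) : calculus V :=
  Calculus (@L_star V) (@iKd_star_rule V).

(* The logics are defined by the calculi with cut; [iKd_calc] and
   [iKd_star_calc] are the cut-free calculi 𝐢𝐊_d and 𝐢𝐊_d*. *)
Definition iKd_logic (V : Type) : formula V -> Prop := logic (STL_NH V).
Definition iKd_star_logic (V : Type) : formula V -> Prop := logic (STL_N V).

(* Main.v *)
Require Import Defs.
From Stdlib Require Import PeanoNat.

Set Implicit Arguments.

(** Cut is eliminated semantically, once, for the full language.  An [L_star]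
    theorem of STL(N) is a theorem of STL(N,H), hence has a proof in the
    cut-free iK_d; up to prefixes of [Nabla] that proof consists of subformulas
    of its conclusion, so [Sup] does not occur in it and it is a proof in iK_d*,
    whose rules are derivable in STL(N).  This closes a circle of inclusions
    between the four calculi ([STL_N_to_STL_NH], [cut_elimination],
    [iKd_conservative], [iKd_star_to_STL_N]); [iKd_to_STL_NH] is the converse of
    cut elimination.

    The model behind [cut_elimination] has the antecedents as its points.  A
    formula denotes a set of antecedents, closed in the sense that it is an
    intersection of sets { Γ | iK_d proves ∇^k Γ, Σ ⇒ Δ }.  Letting k range over
    all numbers makes closed sets stable under inverse image along Γ ↦ ∇Γ.  The
    prefix ∇^n in the left rules of iK_d matches this k: such a rule says that
    its principal formula lies in the intended closed set
    ([forces_self_complete]).  Consequently an antecedent Γ belongs to the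
    denotations of its own members, and whatever lies in the denotation of A
    proves A.  The rules of STL(N,H) are sound in the model, cut being
    transitivity of inclusion ([STL_NH_valid]); evaluating a provable sequent
    at its own antecedent yields a cut-free proof.

    Soundness of the left rules relies on contraction being admissible in iK_d.
    Inverting a left rule replaces a formula by its immediate components, and
    contraction deletes a copy; [iKd_covers] does both together, in a single
    induction on the proof, for antecedents related by [covers]. *)

(** * Proofs up to permutation, and iterated necessitation *)

Lemma nabla_n_succ_r (V : Type) n (A : formula V) :
  nabla_n n (Nabla A) = nabla_n (S n) A.
Proof. symmetry; apply Nat.iter_succ_r. Qed.

Lemma sequent_over_eq (V : Type) (L : formula V -> Prop) S T :
  sequent_eq S T -> sequent_over L T -> sequent_over L S.
Proof.
  intros [HP HE] [HL HR]; split; intros A HA.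
  - apply HL. exact (Permutation_in _ HP HA).
  - apply HR. congruence.
Qed.

Lemma provable_over (V : Type) (G : calculus V) S :
  provable G S -> sequent_over (lang G) S.
Proof. destruct 1; assumption. Qed.

Lemma provable_eq (V : Type) (G : calculus V) S T :
  provable G S -> sequent_eq S T -> provable G T.
Proof.
  intros H [HP HE].
  assert (HO : sequent_over (lang G) T).
  { apply provable_over in H. revert H. apply sequent_over_eq.
    split; [now apply Permutation_sym | now symmetry]. }
  destruct H as [ps c S Hr [HP' HE'] _ Hps].
  apply provable_node with ps c; trivial.
  split; [exact (Permutation_trans HP' HP) | congruence].
Qed.

Lemma provable_perm (V : Type) (G : calculus V) Γ Γ' Δ :
  provable G (Γ ⇒ Δ) -> Permutation Γ Γ' -> provable G (Γ' ⇒ Δ).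
Proof. intros H HP; apply (provable_eq H); split; trivial. Qed.

Lemma provable_rule (V : Type) (G : calculus V) ps c :
  rule G ps c -> sequent_over (lang G) c -> Forall (provable G) ps ->
  provable G c.
Proof.
  intros Hr HL Hps. apply provable_node with ps c; trivial.
  - split; trivial.
  - now apply Forall_forall.
Qed.

Lemma provable_simulation (V : Type) (G G' : calculus V) :
  (forall ps c, rule G ps c -> sequent_over (lang G) c ->
     Forall (provable G') ps -> provable G' c) ->
  forall S, provable G S -> provable G' S.
Proof.
  intros Hsim S H; induction H as [ps c S Hr HE HO _ IH].
  apply provable_eq with c; trivial. apply Hsim with ps; trivial.
  - exact (sequent_over_eq HE HO).
  - now apply Forall_forall.
Qed.

Definition closed_under_N (V : Type) (G : calculus V) : Prop :=
  forall Γ Δ, provable G (Γ ⇒ Δ) ->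
    provable G (map (@Nabla V) Γ ⇒ option_map (@Nabla V) Δ).

Lemma provable_nabla_n (V : Type) (G : calculus V) :
  closed_under_N G ->
  forall n Γ Δ, provable G (Γ ⇒ Δ) ->
    provable G (map (nabla_n n) Γ ⇒ option_map (nabla_n n) Δ).
Proof.
  intros HN n Γ Δ H; induction n as [|n IH].
  - change (nabla_n 0) with (fun A : formula V => A). rewrite map_id.
    destruct Δ; exact H.
  - apply HN in IH. rewrite map_map in IH. destruct Δ; exact IH.
Qed.

(** * The indexed rules are derivable with cut *)

(** Common ground of STL(N) and STL(N,H): the derivations below are carried out
    once, over either language. *)
Record extends_STL_N (V : Type) (G : calculus V) : Prop := {
  ext_rule : forall ps c, STL_N_rule ps c -> rule G ps c;
  ext_Top : lang G Top;
  ext_And : forall A B, lang G (And A B) <-> lang G A /\ lang G B;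
  ext_Or : forall A B, lang G (Or A B) <-> lang G A /\ lang G B;
  ext_Arr : forall A B, lang G (Arr A B) <-> lang G A /\ lang G B;
  ext_Nabla : forall A, lang G (Nabla A) <-> lang G A
}.

Section Derivability.

Variables (V : Type) (G : calculus V).
Hypothesis HG : extends_STL_N G.

#[local] Hint Resolve Forall_cons Forall_nil : core.

Local Notation over Γ := (Forall (lang G) Γ).
Local Notation "⊢ S" := (provable G S) (at level 75).

Lemma over_split Γ Δ :
  sequent_over (lang G) (Γ ⇒ Δ) <->
  over Γ /\ forall A, Δ = Some A -> lang G A.
Proof. unfold sequent_over; simpl; now rewrite Forall_forall. Qed.

Lemma antecedent_over Γ Δ : ⊢ Γ ⇒ Δ -> over Γ.
Proof. intros H; apply provable_over, over_split in H; apply H. Qed.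

Lemma succedent_over Γ A : ⊢ Γ ⇒ Some A -> lang G A.
Proof. intros H; apply provable_over in H; now apply H. Qed.

Lemma stl_step ps Γ Δ :
  STL_N_rule ps (Γ ⇒ Δ) -> over Γ -> (forall A, Δ = Some A -> lang G A) ->
  Forall (provable G) ps -> ⊢ Γ ⇒ Δ.
Proof.
  intros Hr HΓ HΔ Hps. apply provable_rule with ps; trivial.
  - now apply (ext_rule HG).
  - now apply over_split.
Qed.

Lemma over_Some A : lang G A -> forall B, Some A = Some B -> lang G B.
Proof. congruence. Qed.

Local Ltac side := try apply over_Some; auto.

Lemma over_provable Γ Δ : ⊢ Γ ⇒ Δ -> forall B, Δ = Some B -> lang G B.
Proof. intros H B ->. exact (succedent_over H). Qed.

Lemma lang_nabla_n n A : lang G (nabla_n n A) <-> lang G A.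
Proof.
  induction n as [|n IH]; [reflexivity|]. simpl. now rewrite (ext_Nabla HG).
Qed.

Lemma over_map_nabla Γ : over Γ -> over (map (@Nabla V) Γ).
Proof.
  intros H. apply Forall_map. revert H. apply Forall_impl.
  intros A HA; now apply (ext_Nabla HG).
Qed.

(** Weakening by all of [Γ'] first turns every formula of [Γ] into a duplicate
    that contraction removes; [incl] thus ignores multiplicities. *)
Lemma provable_incl Γ Γ' Δ :
  ⊢ Γ ⇒ Δ -> incl Γ Γ' -> over Γ' -> ⊢ Γ' ⇒ Δ.
Proof.
  intros H HI HO.
  assert (Hw : ⊢ Γ ++ Γ' ⇒ Δ).
  { clear HI. apply provable_perm with (Γ' ++ Γ);
      [|apply Permutation_app_comm].
    induction HO as [|A Θ HA HO IH]; trivial. simpl.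
    eapply stl_step; [apply stl_Lw| | |]; eauto using over_provable.
    constructor; trivial. exact (antecedent_over IH). }
  clear H. induction Γ as [|A Γ IH]; trivial.
  apply incl_cons_inv in HI as [HA HI]. apply IH; trivial.
  destruct (in_split A (Γ ++ Γ')) as [Θ1 [Θ2 E]].
  { apply in_or_app; now right. }
  simpl in Hw. rewrite E in Hw |- *.
  apply provable_perm with (A :: Θ1 ++ Θ2); [|apply Permutation_middle].
  apply provable_perm with (Γ' := A :: A :: Θ1 ++ Θ2) in Hw.
  - eapply stl_step; [apply stl_Lc| | |]; eauto using over_provable.
    apply antecedent_over in Hw. now inversion Hw.
  - constructor. symmetry. apply Permutation_middle.
Qed.

Lemma provable_cut Γ A Δ : ⊢ Γ ⇒ Some A -> ⊢ A :: Γ ⇒ Δ -> ⊢ Γ ⇒ Δ.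
Proof.
  intros H1 H2. apply provable_incl with (Γ ++ Γ).
  - eapply stl_step; [apply stl_cut| | |]; eauto using over_provable.
    apply Forall_app; split; exact (antecedent_over H1).
  - apply incl_app; apply incl_refl.
  - exact (antecedent_over H1).
Qed.

Lemma provable_weaken1 F Γ Δ :
  ⊢ [F] ⇒ Δ -> In F Γ -> over Γ -> ⊢ Γ ⇒ Δ.
Proof.
  intros H HF HO. apply (provable_incl H); trivial.
  intros x [<-|[]]; trivial.
Qed.

Lemma provable_id A : lang G A -> ⊢ [A] ⇒ Some A.
Proof.
  intros H; eapply stl_step; [apply stl_Id| | |]; side.
Qed.

#[local] Hint Resolve provable_id : core.

Lemma provable_N : closed_under_N G.
Proof.
  intros Γ Δ H. eapply stl_step; [apply stl_N| | |]; auto.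
  - apply over_map_nabla. exact (antecedent_over H).
  - intros A HA. destruct Δ as [B|]; inversion HA.
    apply (ext_Nabla HG), (succedent_over H).
Qed.

Lemma nabla_n_and_l n A B :
  lang G (And A B) -> ⊢ [nabla_n n (And A B)] ⇒ Some (nabla_n n A).
Proof.
  intros H. pose proof (proj1 (ext_And HG _ _) H) as [HA HB].
  apply (provable_nabla_n provable_N n (Γ := [_]) (Δ := Some _)).
  eapply stl_step; [apply stl_Land1| | |]; side.
Qed.

Lemma nabla_n_and_r n A B :
  lang G (And A B) -> ⊢ [nabla_n n (And A B)] ⇒ Some (nabla_n n B).
Proof.
  intros H. pose proof (proj1 (ext_And HG _ _) H) as [HA HB].
  apply (provable_nabla_n provable_N n (Γ := [_]) (Δ := Some _)).
  eapply stl_step; [apply stl_Land2| | |]; side.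
Qed.

Lemma modus_ponens_arr A B :
  lang G A -> lang G B -> ⊢ [Nabla (Arr A B); A] ⇒ Some B.
Proof.
  intros HA HB.
  assert (lang G (Nabla (Arr A B))) by
    now apply (ext_Nabla HG), (ext_Arr HG).
  eapply stl_step; [apply stl_Larr| | |]; side.
  repeat constructor; auto using provable_id.
  apply provable_weaken1 with B; simpl; auto using provable_id.
Qed.

(** [Nabla] preserves joins because it has the right adjoint [Arr Top]: each of
    [A] and [B] entails [Arr Top (Or (Nabla A) (Nabla B))]. *)
Lemma nabla_or A B :
  lang G A -> lang G B ->
  ⊢ [Nabla (Or A B)] ⇒ Some (Or (Nabla A) (Nabla B)).
Proof.
  intros HA HB. set (C := Or (Nabla A) (Nabla B)).
  pose proof (ext_Top HG) as HT.
  pose proof (proj2 (ext_Nabla HG A) HA) as HnA.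
  pose proof (proj2 (ext_Nabla HG B) HB) as HnB.
  assert (HC : lang G C) by now apply (ext_Or HG).
  assert (HTC : lang G (Arr Top C)) by now apply (ext_Arr HG).
  assert (HAB : lang G (Or A B)) by now apply (ext_Or HG).
  assert (H : ⊢ [Or A B] ⇒ Some (Arr Top C)).
  { eapply stl_step; [apply stl_Lor| | |]; side.
    repeat constructor;
      (eapply stl_step; [apply stl_Rarr| | |]; side;
       repeat constructor; simpl).
    - apply provable_weaken1 with (Nabla A); simpl; auto.
      eapply stl_step; [apply stl_Ror1| | |];
        side.
    - apply provable_weaken1 with (Nabla B); simpl; auto.
      eapply stl_step; [apply stl_Ror2| | |];
        side. }
  apply provable_N in H; simpl in H.
  pose proof (antecedent_over H) as HnAB.
  pose proof (succedent_over H) as HnTC.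
  apply (provable_cut H).
  apply provable_cut with Top.
  - eapply provable_incl with (Γ := []); auto using incl_nil_l.
    eapply stl_step; [apply stl_Rtop| | |]; side.
  - apply provable_incl with [Nabla (Arr Top C); Top]; auto using modus_ponens_arr.
    intros x [<-|[<-|[]]]; simpl; auto.
Qed.

Lemma nabla_n_or n A B :
  lang G A -> lang G B ->
  ⊢ [nabla_n n (Or A B)] ⇒ Some (Or (nabla_n n A) (nabla_n n B)).
Proof.
  intros HA HB; induction n as [|n IH].
  - apply provable_id. now apply (ext_Or HG).
  - apply provable_N in IH; simpl in IH. apply (provable_cut IH).
    apply provable_weaken1 with (Nabla (Or (nabla_n n A) (nabla_n n B)));
      simpl; auto.
    + apply nabla_or; now apply lang_nabla_n.
    + constructor; [exact (succedent_over IH)|exact (antecedent_over IH)].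
Qed.

Lemma nabla_n_arr n A B :
  lang G A -> lang G B ->
  ⊢ [nabla_n (S n) (Arr A B); nabla_n n A] ⇒ Some (nabla_n n B).
Proof.
  intros HA HB. rewrite <- nabla_n_succ_r.
  apply (provable_nabla_n provable_N n (Γ := [_; _]) (Δ := Some _)).
  now apply modus_ponens_arr.
Qed.

(** The shape shared by the rules for both implications, with [F] the prefixed
    implication. *)
Lemma cut_implication F A B Γ Δ :
  ⊢ [F; A] ⇒ Some B -> In F Γ ->
  ⊢ Γ ⇒ Some A -> ⊢ B :: Γ ⇒ Δ -> ⊢ Γ ⇒ Δ.
Proof.
  intros HF Hin H1 H2. apply provable_cut with B; trivial.
  apply (provable_cut H1). apply (provable_incl HF).
  - intros x [<-|[<-|[]]]; simpl; auto.
  - constructor; [exact (succedent_over H1)|exact (antecedent_over H1)].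
Qed.

Lemma iKd_star_rule_derivable ps c :
  iKd_star_rule ps c -> sequent_over (lang G) c ->
  Forall (provable G) ps -> ⊢ c.
Proof.
  intros Hr HO Hps; destruct Hr; rewrite over_split in HO;
    destruct HO as [HΓ HΔ];
    repeat match goal with
    | H : Forall (provable G) (_ :: _) |- _ => inversion H; clear H; subst
    end.
  - eapply stl_step; [apply stl_Id| | |]; auto.
  - eapply stl_step; [apply stl_Lbot| | |]; auto.
  - eapply stl_step; [apply stl_Rtop| | |]; auto.
  - eapply provable_incl; eauto. apply incl_appl, incl_refl.
  - eapply stl_step; [apply stl_Rw| | |]; auto.
  - pose proof (Forall_inv HΓ) as HF. apply lang_nabla_n in HF.
    assert (HA : ⊢ nabla_n n (And A B) :: Γ ⇒ Some (nabla_n n A)).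
    { apply provable_weaken1 with (nabla_n n (And A B));
        [now apply nabla_n_and_l| |]; simpl; auto. }
    assert (HB : ⊢ nabla_n n (And A B) :: Γ ⇒ Some (nabla_n n B)).
    { apply provable_weaken1 with (nabla_n n (And A B));
        [now apply nabla_n_and_r| |]; simpl; auto. }
    apply (provable_cut HB).
    assert (HO : over (nabla_n n B :: nabla_n n (And A B) :: Γ)).
    { constructor; trivial. exact (succedent_over HB). }
    apply provable_cut with (nabla_n n A).
    + apply (provable_incl HA); trivial. apply incl_tl, incl_refl.
    + eapply provable_incl; eauto.
      * intros x [<-|[<-|Hx]]; simpl; auto.
      * constructor; trivial. exact (succedent_over HA).
  - eapply stl_step; [apply stl_Rand| | |]; auto.
  - pose proof (Forall_inv HΓ) as HF.
    apply lang_nabla_n, (ext_Or HG) in HF as [HA HB].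
    pose proof (nabla_n_or n _ _ HA HB) as HD.
    apply provable_cut with (Or (nabla_n n A) (nabla_n n B)).
    + apply (provable_weaken1 HD); simpl; auto.
    + assert (HO : over (Or (nabla_n n A) (nabla_n n B)
                           :: nabla_n n (Or A B) :: Γ)).
      { constructor; trivial. exact (succedent_over HD). }
      apply provable_incl with (Or (nabla_n n A) (nabla_n n B) :: Γ); trivial.
      * eapply stl_step; [apply stl_Lor| |exact HΔ|]; auto.
        constructor; [exact (Forall_inv HO)|exact (Forall_inv_tail HΓ)].
      * intros x [<-|Hx]; simpl; auto.
  - eapply stl_step; [apply stl_Ror1| | |]; auto.
  - eapply stl_step; [apply stl_Ror2| | |]; auto.
  - pose proof (Forall_inv HΓ) as HF.
    apply lang_nabla_n, (ext_Arr HG) in HF as [HA HB].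
    apply (cut_implication (nabla_n_arr n _ _ HA HB)); simpl; auto.
  - eapply stl_step; [apply stl_Rarr| | |]; auto.
  - now apply provable_N.
Qed.

End Derivability.

Lemma STL_N_extends (V : Type) : extends_STL_N (STL_N V).
Proof. constructor; simpl; tauto. Qed.

Lemma STL_NH_extends (V : Type) : extends_STL_N (STL_NH V).
Proof.
  constructor; unfold STL_NH, L_full; simpl; try tauto.
  apply stl_N_rule.
Qed.

Lemma iKd_star_to_STL_N (V : Type) (S : sequent V) :
  provable (iKd_star_calc V) S -> provable (STL_N V) S.
Proof.
  apply provable_simulation. exact (iKd_star_rule_derivable (STL_N_extends V)).
Qed.

Lemma STL_NH_over (V : Type) (S : sequent V) :
  sequent_over (lang (STL_NH V)) S.
Proof. split; intros; exact I. Qed.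

Lemma nabla_n_sup (V : Type) n (A B : formula V) :
  provable (STL_NH V)
    ([nabla_n n (Sup A B); nabla_n n A] ⇒ Some (nabla_n n B)).
Proof.
  pose proof (STL_NH_extends V) as HG.
  apply (provable_nabla_n (provable_N HG) n (Γ := [_; _]) (Δ := Some _)).
  apply (@provable_rule _ (STL_NH V) [[A] ⇒ Some A; [B; A] ⇒ Some B]);
    [apply stl_Lsup|apply STL_NH_over|].
  repeat constructor.
  - now apply (provable_id HG).
  - apply (provable_weaken1 HG (F := B)); simpl; auto.
    + now apply (provable_id HG).
    + now repeat constructor.
Qed.

Lemma iKd_to_STL_NH (V : Type) (S : sequent V) :
  provable (iKd_calc V) S -> provable (STL_NH V) S.
Proof.
  pose proof (STL_NH_extends V) as HG. revert S.
  apply provable_simulation. intros ps c [ps' c' Hr|n Γ Δ A B|Γ A B] HO Hps.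
  - now apply (iKd_star_rule_derivable HG Hr).
  - inversion Hps as [|? ? H1 Hps']; inversion Hps' as [|? ? H2 _]; subst.
    apply (cut_implication HG (nabla_n_sup n A B)); simpl; auto.
    apply (provable_incl HG H2).
    + intros x [<-|Hx]; simpl; auto.
    + apply Forall_forall; intros; exact I.
  - apply provable_rule with [A :: Γ ⇒ Some B]; trivial. apply stl_Rsup.
Qed.

Lemma STL_N_to_STL_NH (V : Type) (S : sequent V) :
  provable (STL_N V) S -> provable (STL_NH V) S.
Proof.
  apply provable_simulation. intros ps c Hr _ Hps.
  apply provable_rule with ps; trivial.
  - now apply stl_N_rule.
  - apply STL_NH_over.
Qed.

(** * Contraction is admissible without cut *)

(** [covered Θ n A] means that [nabla_n n A] can be reassembled from members of
    [Θ] by undoing inverted left rules.  [Sup B C] is covered by [C] alone, as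
    only the right premise of its left rule is invertible; [Arr] is never
    decomposed, since its left rule keeps the principal formula in both
    premises.  Carrying the prefix as an argument makes the definition
    structural in the formula. *)
Fixpoint covered (V : Type) (Θ : list (formula V)) (n : nat) (A : formula V)
    : Prop :=
  In (nabla_n n A) Θ \/
  match A with
  | And B C => covered Θ n B /\ covered Θ n C
  | Or B C => covered Θ n B \/ covered Θ n C
  | Sup B C => covered Θ n C
  | Nabla B => covered Θ (S n) B
  | _ => False
  end.

Definition covers (V : Type) (Θ Γ : list (formula V)) : Prop :=
  forall A, In A Γ -> covered Θ 0 A.

Lemma covered_in (V : Type) Θ n (A : formula V) :
  In (nabla_n n A) Θ -> covered Θ n A.
Proof. destruct A; simpl; auto. Qed.

Lemma covered_nabla_n (V : Type) Θ n m (A : formula V) :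
  covered Θ m (nabla_n n A) <-> covered Θ (n + m) A.
Proof.
  revert m; induction n as [|n IH]; intros m; [reflexivity|].
  change (nabla_n (S n) A) with (Nabla (nabla_n n A)).
  replace (S n + m) with (n + S m) by (simpl; apply Nat.add_succ_r).
  rewrite <- IH. simpl. split; [|now right].
  intros [H|H]; trivial. apply covered_in. now rewrite <- nabla_n_succ_r.
Qed.

Lemma covered_nabla_n0 (V : Type) Θ n (A : formula V) :
  covered Θ 0 (nabla_n n A) <-> covered Θ n A.
Proof. rewrite covered_nabla_n. now rewrite Nat.add_0_r. Qed.

Lemma covered_trans (V : Type) Θ Θ' n (A : formula V) :
  covers Θ' Θ -> covered Θ n A -> covered Θ' n A.
Proof.
  intros HΘ. revert n.
  induction A as [p| | |B IHB C IHC|B IHB C IHC|B IHB C IHC|B IHB C IHC|B IHB];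
    intros n [H|H];
    try (apply covered_nabla_n0; apply HΘ; exact H); simpl; firstorder.
Qed.

Lemma incl_covers (V : Type) (Θ Γ : list (formula V)) :
  incl Γ Θ -> covers Θ Γ.
Proof. intros H A HA; now apply covered_in, H. Qed.

Lemma covers_trans (V : Type) (Θ' Θ Γ : list (formula V)) :
  covers Θ' Θ -> covers Θ Γ -> covers Θ' Γ.
Proof. intros H H' A HA. exact (covered_trans 0 A H (H' A HA)). Qed.

Lemma covers_cons (V : Type) Θ Γ (A : formula V) :
  covers Θ (A :: Γ) <-> covered Θ 0 A /\ covers Θ Γ.
Proof.
  split.
  - intros H; split; [|intros B HB]; apply H; simpl; auto.
  - intros [H1 H2] B [<-|HB]; auto.
Qed.

Definition denabla (V : Type) : list (formula V) -> list (formula V) :=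
  flat_map (fun A => match A with Nabla B => [B] | _ => [] end).

Lemma in_denabla (V : Type) Θ (A : formula V) :
  In (Nabla A) Θ -> In A (denabla Θ).
Proof.
  intros H. apply in_flat_map. exists (Nabla A). simpl; auto.
Qed.

Lemma denabla_rest (V : Type) (Θ : list (formula V)) :
  exists Σ, Permutation (map (@Nabla V) (denabla Θ) ++ Σ) Θ.
Proof.
  induction Θ as [|A Θ [Σ IH]]; [now exists []|].
  destruct A;
    try (match goal with |- context [?A :: Θ] => exists (A :: Σ) end;
         symmetry; apply Permutation_cons_app; symmetry; exact IH).
  exists Σ; simpl; now constructor.
Qed.

Lemma covered_denabla (V : Type) Θ n (A : formula V) :
  covered Θ (S n) A -> covered (denabla Θ) n A.
Proof.
  revert n.
  induction A as [p| | |B IHB C IHC|B IHB C IHC|B IHB C IHC|B IHB C IHC|B IHB];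
    intros n [H|H];
    try (apply covered_in, in_denabla; exact H); simpl; firstorder.
Qed.

Lemma covered_map_nabla (V : Type) Θ n (A : formula V) :
  covered Θ n A -> covered (map (@Nabla V) Θ) (S n) A.
Proof.
  revert n.
  induction A as [p| | |B IHB C IHC|B IHB C IHC|B IHB C IHC|B IHB C IHC|B IHB];
    intros n [H|H];
    try (apply covered_in; exact (in_map (@Nabla V) _ _ H));
    simpl; firstorder.
Qed.

Lemma covers_denabla (V : Type) (Θ Γ : list (formula V)) :
  covers Θ (map (@Nabla V) Γ) -> covers (denabla Θ) Γ.
Proof.
  intros H A HA. apply covered_denabla.
  apply (covered_nabla_n0 Θ 1 A). now apply H, in_map.
Qed.

Lemma covers_map_nabla (V : Type) (Θ Γ : list (formula V)) :
  covers Θ Γ -> covers (map (@Nabla V) Θ) (map (@Nabla V) Γ).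
Proof.
  intros H A HA. apply in_map_iff in HA as [B [<- HB]].
  apply (covered_nabla_n0 _ 1 B). now apply covered_map_nabla, H.
Qed.

Section CutFree.

Variable V : Type.

Local Notation "⊢ S" := (provable (iKd_calc V) S) (at level 75).
Local Notation "'∇'" := (@Nabla V).
Local Notation "∇^ n" := (@nabla_n V n) (at level 5, n at level 0).

Lemma iKd_step ps c : iKd_rule ps c -> Forall (provable (iKd_calc V)) ps -> ⊢ c.
Proof.
  intros Hr Hps. apply provable_rule with ps; trivial.
  split; intros; exact I.
Qed.

Lemma iKd_star_step ps c :
  iKd_star_rule ps c -> Forall (provable (iKd_calc V)) ps -> ⊢ c.
Proof. intros Hr; apply iKd_step; now constructor. Qed.

Lemma iKd_weaken_perm Γ Γ' Σ Δ :
  ⊢ Γ ⇒ Δ -> Permutation (Γ ++ Σ) Γ' -> ⊢ Γ' ⇒ Δ.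
Proof.
  intros H HP. refine (provable_perm _ HP).
  eapply iKd_star_step; [apply ikd_LW|auto].
Qed.

Lemma iKd_in_weaken A Θ Δ : ⊢ [A] ⇒ Δ -> In A Θ -> ⊢ Θ ⇒ Δ.
Proof.
  intros H HA. destruct (in_split _ _ HA) as [Θ1 [Θ2 ->]].
  apply (iKd_weaken_perm (Θ1 ++ Θ2) H).
  exact (Permutation_middle Θ1 Θ2 A).
Qed.

(** [Θ'] with the components [Σ] may stand for [Θ], where [A] is the formula
    they replace. *)
Lemma covers_swap Θ Θ' (A : formula V) Σ Γ :
  Permutation Θ (A :: Θ') -> covered (Σ ++ Θ') 0 A -> covers Θ Γ ->
  covers (Σ ++ Θ') Γ.
Proof.
  intros HP HA. apply covers_trans. intros B HB.
  apply (Permutation_in _ HP) in HB as [<-|HB].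
  - exact HA.
  - apply incl_covers with Θ'; trivial. apply incl_appr, incl_refl.
Qed.

Lemma in_perm_cons (A : formula V) Θ :
  In A Θ -> exists Θ', Permutation Θ (A :: Θ').
Proof.
  intros H. destruct (in_split _ _ H) as [Θ1 [Θ2 ->]].
  exists (Θ1 ++ Θ2). symmetry. apply Permutation_middle.
Qed.

(** Weakening, contraction and the left inversions together.  For the principal
    formula of the last rule there are two possibilities.  If it is a member of
    [Θ], the same rule is applied to [Θ], and the components that replace it
    there still cover it, which disposes of its further copies.  If it is only
    covered through components, [Θ] already covers a premise.  The rule N is no
    obstacle, because the decomposition of a formula under [Nabla] uses only
    formulas under [Nabla] ([covers_denabla]). *)
Lemma iKd_covers S Θ :
  ⊢ S -> covers Θ (antecedent S) -> ⊢ Θ ⇒ succedent S.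
Proof.
  intros H; revert Θ; induction H as [ps c S Hr [HP HE] _ _ IH].
  rewrite <- HE. intros Θ HΘ.
  assert (HC : covers Θ (antecedent c)).
  { intros A HA; apply HΘ. exact (Permutation_in _ HP HA). }
  clear S HP HE HΘ.
  assert (IH' : Forall (fun P => forall Θ, covers Θ (antecedent P) ->
                          ⊢ Θ ⇒ succedent P) ps)
    by now apply Forall_forall.
  clear IH.
  destruct Hr as [ps c Hr|n Γ Δ A B|Γ A B]; [destruct Hr|..];
    repeat match goal with
    | H : Forall _ (_ :: _) |- _ => apply Forall_cons_iff in H as [? H]
    end; simpl in *; try rewrite covers_cons in HC.
  - destruct HC as [[Hp|[]] _].
    apply iKd_in_weaken with (Atom p); trivial.
    eapply iKd_star_step; [apply ikd_Idp|auto].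
  - destruct HC as [[Hp|[]] _].
    apply iKd_in_weaken with Bot; trivial.
    eapply iKd_star_step; [apply ikd_Lbot|auto].
  - apply (@iKd_weaken_perm [] Θ Θ); trivial.
    eapply iKd_star_step; [apply ikd_Rtop|auto].
  - apply H. intros A HA; apply HC, in_or_app; auto.
  - eapply iKd_star_step; [apply ikd_Rw|auto].
  - destruct HC as [HF HC]. apply covered_nabla_n0 in HF as [HF|[HA HB]].
    + destruct (in_perm_cons _ _ HF) as [Θ' HP].
      refine (provable_perm _ (Permutation_sym HP)).
      eapply iKd_star_step; [apply ikd_Land|repeat constructor].
      assert (HS : covered ([nabla_n n A; nabla_n n B] ++ Θ') 0
                     (nabla_n n (And A B))).
      { apply covered_nabla_n0. right; split; apply covered_in; simpl; auto. }
      apply H. rewrite !covers_cons. repeat split.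
      1,2: apply covered_in; simpl; auto.
      exact (covers_swap _ HP HS HC).
    + apply H. rewrite !covers_cons, !covered_nabla_n0; auto.
  - eapply iKd_star_step; [apply ikd_Rand|auto].
  - destruct HC as [HF HC]. apply covered_nabla_n0 in HF as [HF|[HA|HB]].
    + destruct (in_perm_cons _ _ HF) as [Θ' HP].
      refine (provable_perm _ (Permutation_sym HP)).
      eapply iKd_star_step; [apply ikd_Lor|repeat constructor].
      * apply H. rewrite covers_cons. split; [apply covered_in; simpl; auto|].
        apply (covers_swap [nabla_n n A] HP); trivial.
        apply covered_nabla_n0. right; left; apply covered_in; simpl; auto.
      * apply H0. rewrite covers_cons. split; [apply covered_in; simpl; auto|].
        apply (covers_swap [nabla_n n B] HP); trivial.
        apply covered_nabla_n0. right; right; apply covered_in; simpl; auto.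
    + apply H. rewrite !covers_cons, !covered_nabla_n0; auto.
    + apply H0. rewrite !covers_cons, !covered_nabla_n0; auto.
  - eapply iKd_star_step; [apply ikd_Ror1|auto].
  - eapply iKd_star_step; [apply ikd_Ror2|auto].
  - assert (HF : In (nabla_n (S n) (Arr A B)) Θ).
    { destruct HC as [HF _].
      apply (covered_nabla_n0 Θ (S n) (Arr A B)) in HF as [HF|[]]; trivial. }
    destruct (in_perm_cons _ _ HF) as [Θ' HP].
    apply covers_cons in HC.
    refine (provable_perm _ (Permutation_sym HP)).
    eapply iKd_star_step; [apply ikd_Larr|repeat constructor].
    + apply (provable_perm (H _ HC) HP).
    + apply provable_perm with (nabla_n n B :: Θ); [|now constructor].
      apply H0. rewrite covers_cons. split; [apply covered_in; simpl; auto|].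
      refine (covers_trans _ HC). apply incl_covers, incl_tl, incl_refl.
  - eapply iKd_star_step; [apply ikd_Rarr|repeat constructor].
    apply H. rewrite covers_cons. split; [apply covered_in; simpl; auto|].
    apply covers_map_nabla in HC. refine (covers_trans _ HC).
    apply incl_covers, incl_tl, incl_refl.
  - destruct (denabla_rest Θ) as [Σ HP].
    refine (iKd_weaken_perm Σ _ HP).
    eapply iKd_star_step; [apply ikd_N|repeat constructor].
    apply H. now apply covers_denabla.
  - destruct (HC) as [HF HΓ]. apply covered_nabla_n0 in HF as [HF|HB].
    + destruct (in_perm_cons _ _ HF) as [Θ' HP].
      apply covers_cons in HC.
      refine (provable_perm _ (Permutation_sym HP)).
      eapply iKd_step; [apply ikd_Lsup|repeat constructor].
      * apply (provable_perm (H _ HC) HP).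
      * apply H0. rewrite covers_cons. split; [apply covered_in; simpl; auto|].
        apply (covers_swap [nabla_n n B] HP); trivial.
        apply covered_nabla_n0. right; apply covered_in; simpl; auto.
    + apply H0. rewrite !covers_cons, !covered_nabla_n0; auto.
  - eapply iKd_step; [apply ikd_Rsup|repeat constructor].
    apply H. rewrite covers_cons. split; [apply covered_in; simpl; auto|].
    refine (covers_trans _ HC). apply incl_covers, incl_tl, incl_refl.
Qed.

Lemma iKd_incl Γ Γ' Δ : ⊢ Γ ⇒ Δ -> incl Γ Γ' -> ⊢ Γ' ⇒ Δ.
Proof.
  intros H HI. apply (iKd_covers H). now apply incl_covers.
Qed.

Lemma iKd_N : closed_under_N (iKd_calc V).
Proof. intros Γ Δ H. eapply iKd_star_step; [apply ikd_N|auto]. Qed.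

(** * Semantic cut elimination *)

Definition context : Type := list (formula V).

Implicit Types (X Y : context -> Prop) (w x y : context).

(** The least closed set containing [X].  The exponent [k] makes closed sets
    stable under inverse image along [map ∇], as the clause of [forces] for
    [Arr] demands. *)
Definition closure X : context -> Prop := fun w =>
  forall k Σ Δ,
    (forall x, X x -> ⊢ map (∇^k) x ++ Σ ⇒ Δ) -> ⊢ map (∇^k) w ++ Σ ⇒ Δ.

Definition closed X : Prop := forall w, closure X w -> X w.

(** [Or] and [Nabla] are left adjoints, hence need a closure; the other clauses
    yield closed sets directly. *)
Fixpoint forces (A : formula V) : context -> Prop :=
  match A with
  | Atom p => fun w => ⊢ w ⇒ Some (Atom p)
  | Top => fun _ => True
  | Bot => fun w => ⊢ w ⇒ None
  | And B C => fun w => forces B w /\ forces C w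
  | Or B C => closure (fun w => forces B w \/ forces C w)
  | Sup B C => fun w => forall x, forces B x -> forces C (w ++ x)
  | Arr B C => fun w => forall x, forces B x -> forces C (map ∇ w ++ x)
  | Nabla B => closure (fun w => exists x, w = map ∇ x /\ forces B x)
  end.

Definition forces_all (Γ : context) : context -> Prop := fun w =>
  forall A, In A Γ -> forces A w.

Definition forces_succedent (Δ : option (formula V)) : context -> Prop :=
  match Δ with
  | Some A => forces A
  | None => fun w => ⊢ w ⇒ None
  end.

Lemma closure_unit X w : X w -> closure X w.
Proof. intros Hw k Σ Δ H; now apply H. Qed.

Lemma map_nabla_n_nabla k x : map (∇^k) (map ∇ x) = map (∇^(S k)) x.
Proof. rewrite map_map. apply map_ext. intros A; apply nabla_n_succ_r. Qed.

Lemma closure_trans X Y w :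
  (forall x, X x -> closure Y x) -> closure X w -> closure Y w.
Proof. intros HXY Hw k Σ Δ H. apply Hw. intros x Hx. now apply HXY. Qed.

Lemma closure_provable X w Δ :
  closure X w -> (forall x, X x -> ⊢ x ⇒ Δ) -> ⊢ w ⇒ Δ.
Proof.
  intros Hw H. specialize (Hw 0 [] Δ).
  change (nabla_n 0) with (fun A : formula V => A) in Hw.
  rewrite map_id, app_nil_r in Hw. apply Hw. intros x Hx.
  rewrite map_id, app_nil_r. now apply H.
Qed.

Lemma closed_provable Δ : closed (fun w => ⊢ w ⇒ Δ).
Proof. intros w Hw. now apply (closure_provable Hw). Qed.

Lemma closure_app X Y w x :
  (forall z, X z -> closure Y (z ++ x)) -> closure X w -> closure Y (w ++ x).
Proof.
  intros HXY Hw k Σ Δ H. rewrite map_app, <- app_assoc. apply Hw.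
  intros z Hz. rewrite app_assoc, <- map_app. now apply HXY.
Qed.

Lemma closure_map_nabla_app X Y w x :
  (forall z, X z -> closure Y (map ∇ z ++ x)) ->
  closure X w -> closure Y (map ∇ w ++ x).
Proof.
  intros HXY Hw k Σ Δ H.
  rewrite map_app, map_nabla_n_nabla, <- app_assoc. apply Hw.
  intros z Hz. rewrite app_assoc, <- map_nabla_n_nabla, <- map_app.
  now apply HXY.
Qed.

Lemma forces_closed A : closed (forces A).
Proof.
  induction A as [p| | |B IHB C IHC|B IHB C IHC|B IHB C IHC|B IHB C IHC|B IHB];
    simpl; try apply closed_provable; intros w Hw.
  - exact I.
  - split; [apply IHB|apply IHC]; revert Hw; apply closure_trans;
      intros x [HB HC]; now apply closure_unit.
  - revert Hw. apply closure_trans; trivial.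
  - intros x Hx. apply IHC. revert Hw. apply closure_app.
    intros z Hz; apply closure_unit; now apply Hz.
  - intros x Hx. apply IHC. revert Hw. apply closure_map_nabla_app.
    intros z Hz; apply closure_unit; now apply Hz.
  - revert Hw. apply closure_trans; trivial.
Qed.

Lemma forces_succedent_closed Δ : closed (forces_succedent Δ).
Proof.
  destruct Δ as [A|]; [apply forces_closed|apply closed_provable].
Qed.

Lemma closure_incl X w x : incl w x -> closure X w -> closure X x.
Proof.
  intros HI Hw k Σ Δ H. apply (iKd_incl (Hw k Σ Δ H)).
  apply incl_app_app; [now apply incl_map|apply incl_refl].
Qed.

Lemma closed_incl X w x : closed X -> incl w x -> X w -> X x.
Proof.
  intros HX HI Hw. apply HX. apply (closure_incl HI). now apply closure_unit.
Qed.

Lemma forces_incl A w x : incl w x -> forces A w -> forces A x.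
Proof. apply closed_incl, forces_closed. Qed.

Lemma forces_all_incl Γ w x : incl w x -> forces_all Γ w -> forces_all Γ x.
Proof. intros HI H A HA. apply (forces_incl A HI), H, HA. Qed.

Lemma forces_all_cons A Γ w :
  forces_all (A :: Γ) w <-> forces A w /\ forces_all Γ w.
Proof.
  split.
  - intros H; split; [|intros B HB]; apply H; simpl; auto.
  - intros [H1 H2] B [<-|HB]; auto.
Qed.

(** Distributivity of meets over the joins of closed sets, as a rule: while
    eliminating from a closure that holds at [w], the information at [w] is
    retained.  It duplicates [w], hence rests on contraction. *)
Lemma closed_elim X Y w :
  closed Y -> closure X w -> (forall x, X x -> Y (x ++ w)) -> Y w.
Proof.
  intros HY Hw H. apply closed_incl with (w ++ w); trivial.
  { apply incl_app; apply incl_refl. }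
  apply HY. revert Hw. apply closure_app. intros z Hz.
  now apply closure_unit, H.
Qed.

(** The first half is what the prefixed left rules say, read through the
    definition of [closure]; the second comes from the right rules.  Each half
    for an implication uses the other half for its antecedent, so they are
    proved together. *)
Lemma forces_self_complete A :
  forces A [A] /\ forall w, forces A w -> ⊢ w ⇒ Some A.
Proof.
  induction A as [p| | |A [IA CA] B [IB CB]|A [IA CA] B [IB CB]
    |A [IA CA] B [IB CB]|A [IA CA] B [IB CB]|A [IA CA]]; simpl; split.
  - eapply iKd_star_step; [apply ikd_Idp|auto].
  - trivial.
  - trivial.
  - intros w _. apply (iKd_incl (Γ := [])); [|apply incl_nil_l].
    eapply iKd_star_step; [apply ikd_Rtop|auto].
  - eapply iKd_star_step; [apply ikd_Lbot|auto].
  - intros w Hw. eapply iKd_star_step; [apply ikd_Rw|auto].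
  - split; apply forces_closed; intros k Σ Δ H;
      [apply H in IA|apply H in IB];
      (eapply iKd_star_step; [apply ikd_Land|repeat constructor]).
    + apply (iKd_incl IA). intros C [<-|HC]; simpl; auto.
    + apply (iKd_incl IB). intros C [<-|HC]; simpl; auto.
  - intros w [HA HB]. eapply iKd_star_step; [apply ikd_Rand|auto].
  - intros k Σ Δ H.
    eapply iKd_star_step; [apply ikd_Lor|repeat constructor].
    + apply (H [A]); auto.
    + apply (H [B]); auto.
  - intros w Hw. apply (closure_provable Hw). intros x [Hx|Hx].
    + eapply iKd_star_step; [apply ikd_Ror1|auto].
    + eapply iKd_star_step; [apply ikd_Ror2|auto].
  - intros x Hx. apply forces_closed. intros k Σ Δ H.
    eapply iKd_step; [apply ikd_Lsup|repeat constructor].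
    + apply CA in Hx. apply (provable_nabla_n iKd_N k) in Hx.
      apply (iKd_incl Hx). apply incl_tl, incl_appl, incl_refl.
    + apply H in IB. apply (iKd_incl IB). intros C [<-|HC]; simpl; auto.
      right. now apply in_or_app; right.
  - intros w Hw. eapply iKd_step; [apply ikd_Rsup|repeat constructor].
    apply CB. apply forces_incl with (w ++ [A]); auto.
    intros C HC. apply in_app_or in HC as [HC|[<-|[]]]; simpl; auto.
  - intros x Hx. apply forces_closed. intros k Σ Δ H.
    simpl. rewrite nabla_n_succ_r.
    eapply iKd_star_step; [apply ikd_Larr|repeat constructor].
    + apply CA in Hx. apply (provable_nabla_n iKd_N k) in Hx.
      apply (iKd_incl Hx). apply incl_tl, incl_appl, incl_refl.
    + apply H in IB. apply (iKd_incl IB). intros C [<-|HC]; simpl; auto.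
      right. right. now apply in_or_app; right.
  - intros w Hw. eapply iKd_star_step; [apply ikd_Rarr|repeat constructor].
    apply CB. apply forces_incl with (map ∇ w ++ [A]); auto.
    intros C HC. apply in_app_or in HC as [HC|[<-|[]]]; simpl; auto.
  - apply closure_unit. now exists [A].
  - intros w Hw. apply (closure_provable Hw). intros x [y [-> Hy]].
    apply CA in Hy. now apply iKd_N in Hy.
Qed.

(** [Nabla] preserves finite meets of denotations: witnesses for the single
    formulas are merged by concatenation. *)
Lemma forces_all_nabla Γ w :
  forces_all (map ∇ Γ) w ->
  closure (fun y => exists x, y = map ∇ x /\ forces_all Γ x) w.
Proof.
  induction Γ as [|A Γ IH]; intros Hw.
  - (* The empty meet: the empty antecedent is its own image under [map ∇]. *)
    apply closure_incl with []; [apply incl_nil_l|].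
    apply closure_unit. exists []. split; trivial. intros A [].
  - apply forces_all_cons in Hw as [HA HΓ]. specialize (IH HΓ).
    apply (closed_elim (X := fun y => exists x, y = map ∇ x /\ forces A x));
      trivial.
    { intros z; now apply closure_trans. }
    intros ? [x [-> Hx]].
    apply closure_incl with (w ++ map ∇ x).
    { apply incl_app; [apply incl_appr|apply incl_appl]; apply incl_refl. }
    revert IH. apply closure_app. intros ? [y [-> Hy]].
    apply closure_unit. exists (y ++ x). rewrite map_app; split; trivial.
    apply forces_all_cons; split.
    + apply forces_incl with x; trivial. apply incl_appr, incl_refl.
    + apply forces_all_incl with y; trivial. apply incl_appl, incl_refl.
Qed.

Definition valid (S : sequent V) : Prop :=
  forall w, forces_all (antecedent S) w -> forces_succedent (succedent S) w.

Lemma STL_N_rule_valid ps c :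
  STL_N_rule ps c -> Forall valid ps -> valid c.
Proof.
  intros Hr Hps; destruct Hr;
    repeat match goal with
    | H : Forall _ (_ :: _) |- _ => apply Forall_cons_iff in H as [? H]
    end; unfold valid in *; simpl in *; intros w Hw;
    try rewrite forces_all_cons in Hw; try destruct Hw as [HA HΓ].
  - exact HA.
  - exact HA.
  - exact I.
  - now apply H.
  - apply forces_closed. intros k Σ Δ _. apply H in Hw.
    apply (provable_nabla_n iKd_N k) in Hw.
    assert (HN : ⊢ map (∇^k) w ++ Σ ⇒ None)
      by (apply (iKd_incl Hw), incl_appl, incl_refl).
    destruct Δ; trivial. eapply iKd_star_step; [apply ikd_Rw|auto].
  - apply H. rewrite !forces_all_cons; auto.
  - apply H0. apply forces_all_cons; split.
    + apply H. intros B HB; apply Hw, in_or_app; auto.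
    + intros B HB; apply Hw, in_or_app; auto.
  - apply H. rewrite forces_all_cons. destruct HA; auto.
  - apply H. rewrite forces_all_cons. destruct HA; auto.
  - auto.
  - apply (closed_elim (forces_succedent_closed Δ) HA).
    intros x Hx.
    assert (HΓ' : forces_all Γ (x ++ w)).
    { apply forces_all_incl with w; trivial. apply incl_appr, incl_refl. }
    destruct Hx as [Hx|Hx]; [apply H|apply H0]; apply forces_all_cons;
      split; trivial; apply forces_incl with x; trivial;
      apply incl_appl, incl_refl.
  - apply closure_unit; auto.
  - apply closure_unit; auto.
  - apply forces_all_nabla in Hw. destruct Δ as [A|]; simpl in *.
    + revert Hw. apply closure_trans. intros ? [x [-> Hx]].
      apply closure_unit. exists x; auto.
    + apply (closure_provable Hw). intros ? [x [-> Hx]].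
      apply H in Hx. now apply iKd_N in Hx.
  - apply H0. apply forces_all_cons; split; trivial.
    apply (closed_elim (forces_closed B) HA). intros ? [x [-> Hx]].
    apply Hx, H, HΓ.
  - intros x Hx. apply H. apply forces_all_cons; split.
    + apply forces_incl with x; trivial. apply incl_appr, incl_refl.
    + intros C HC. apply in_map_iff in HC as [D [<- HD]].
      apply closure_incl with (map ∇ w); [apply incl_appl, incl_refl|].
      apply closure_unit. exists w. split; [reflexivity|exact (Hw _ HD)].
Qed.

Lemma STL_NH_valid S : provable (STL_NH V) S -> valid S.
Proof.
  induction 1 as [ps c S Hr [HP HE] _ _ IH].
  assert (Hc : valid c).
  { apply Forall_forall in IH. clear S HP HE.
    destruct Hr as [ps c Hr|Γ Δ A B|Γ A B].
    - exact (STL_N_rule_valid Hr IH).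
    - apply Forall_cons_iff in IH as [H1 IH].
      apply Forall_cons_iff in IH as [H2 _].
      intros w Hw. apply forces_all_cons in Hw as [HF HΓ].
      apply H2. apply forces_all_cons; split; trivial.
      apply forces_incl with (w ++ w).
      + apply incl_app; apply incl_refl.
      + apply HF, H1, HΓ.
    - apply Forall_cons_iff in IH as [H _]. intros w Hw x Hx.
      apply H. apply forces_all_cons; split.
      + apply forces_incl with x; trivial. apply incl_appr, incl_refl.
      + apply forces_all_incl with w; trivial.
        apply incl_appl, incl_refl. }
  intros w Hw. rewrite <- HE. apply Hc. intros A HA.
  apply Hw. exact (Permutation_in _ HP HA).
Qed.

Theorem cut_elimination S : provable (STL_NH V) S -> ⊢ S.
Proof.
  destruct S as [Γ Δ]. intros H.
  assert (HΓ : forces_all Γ Γ).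
  { intros A HA. apply forces_incl with [A].
    - intros B [<-|[]]; exact HA.
    - apply forces_self_complete. }
  apply (STL_NH_valid H) in HΓ. destruct Δ as [A|]; simpl in HΓ; trivial.
  now apply forces_self_complete.
Qed.

End CutFree.

(** * Subformula property and conservativity *)

Lemma L_star_nabla_n (V : Type) n (A : formula V) :
  L_star (nabla_n n A) <-> L_star A.
Proof. exact (lang_nabla_n (STL_N_extends V) n A). Qed.

Lemma iKd_star_premises_over (V : Type) ps (c : sequent V) :
  iKd_star_rule ps c -> sequent_over (@L_star V) c ->
  Forall (sequent_over (@L_star V)) ps.
Proof.
  intros Hr HO; destruct Hr; apply (over_split (STL_N V)) in HO;
    destruct HO as [HΓ HΔ]; simpl in HΓ, HΔ;
    repeat (apply Forall_cons; [|]); try apply Forall_nil;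
    apply (over_split (STL_N V)); simpl.
  all: try specialize (HΔ _ eq_refl).
  all: rewrite ?Forall_cons_iff, ?Forall_app, ?Forall_map in *.
  all: try change (Nabla (nabla_n n (Arr A B)))
         with (nabla_n (S n) (Arr A B)) in *.
  all: rewrite ?L_star_nabla_n in *; simpl in *.
  all: split; [tauto|].
  all: intros C HC.
  all: first
    [ now apply HΔ
    | discriminate HC
    | injection HC as <-; rewrite ?L_star_nabla_n; tauto
    | subst Δ; exact (HΔ _ eq_refl) ].
Qed.

(** A last step by a rule for [Sup] would put its principal formula, possibly
    prefixed, into the conclusion. *)
Lemma iKd_conservative (V : Type) (S : sequent V) :
  provable (iKd_calc V) S -> sequent_over (@L_star V) S ->
  provable (iKd_star_calc V) S.
Proof.
  induction 1 as [ps c S Hr HE _ _ IH]; intros HO.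
  pose proof (sequent_over_eq HE HO) as Hc.
  destruct Hr as [ps c Hr|n Γ Δ A B|Γ A B].
  - pose proof (iKd_star_premises_over Hr Hc) as Hps.
    rewrite Forall_forall in Hps.
    apply provable_node with ps c; auto.
  - destruct Hc as [Hc _]. specialize (Hc _ (or_introl eq_refl)).
    now apply L_star_nabla_n in Hc.
  - destruct Hc as [_ Hc]. destruct (Hc _ eq_refl).
Qed.

Theorem corollary9 (V : Type) :
  (forall A : formula V,
     iKd_logic A <-> provable (iKd_calc V) ([] ⇒ Some A)) /\
  (forall A : formula V, L_star A ->
     (iKd_star_logic A <-> provable (iKd_star_calc V) ([] ⇒ Some A))) /\
  (forall A : formula V, L_star A ->
     (iKd_logic A <-> iKd_star_logic A)).
Proof.
  assert (Hcut : forall A : formula V,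
    iKd_logic A <-> provable (iKd_calc V) ([] ⇒ Some A)).
  { intros A; split.
    - intros [_ H]. now apply cut_elimination.
    - intros H. split; [exact I|now apply iKd_to_STL_NH]. }
  assert (Hcons : forall A : formula V, L_star A -> iKd_logic A ->
    provable (iKd_star_calc V) ([] ⇒ Some A)).
  { intros A HA H. apply iKd_conservative; [now apply Hcut|].
    split; [intros B []|simpl; congruence]. }
  assert (Hfull : forall A : formula V, iKd_star_logic A -> iKd_logic A).
  { intros A [_ H]. split; [exact I|now apply STL_N_to_STL_NH]. }
  assert (Hstar : forall A : formula V, L_star A ->
    provable (iKd_star_calc V) ([] ⇒ Some A) -> iKd_star_logic A).
  { intros A HA H. split; [exact HA|now apply iKd_star_to_STL_N]. }
  split; [exact Hcut|]. split; intros A HA; split; auto.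
Qed.
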